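(* Let $\mathrm{Mon}\subset\mathrm{GL}_4(\mathbb{C})$ be the monodromy group of Appell's system $F_4(a,b,c_1,c_2)$ with $a=b=\frac12$, $c_1=c_2=1$, which in a suitable basis is generated by the matrices $M_0',M_1',M_2'$ given in the context. Then the subgroup of $\mathrm{Mon}$ generated by $$M_1',\quad M_2',\quad M_0'M_1'M_0',\quad M_0'M_2'M_0'$$ has index $2$, and as a group of projective transformations (i.e. its image in $\mathrm{PGL}_4(\mathbb{C})$) it is isomorphic to $\Gamma(2)\times\Gamma(2)$ acting projectively, i.e. to $\Gamma(2)/\{\pm1\}\times\Gamma(2)/\{\pm1\}$.
   Context: $$M_0'=\begin{pmatrix}0&0&0&-1\\0&1&0&0\\0&0&1&0\\-1&0&0&0\end{pmatrix},\quad M_1'=\begin{pmatrix}1&-2&0&0\\0&1&0&0\\0&0&1&-2\\0&0&0&1\end{pmatrix},\quad M_2'=\begin{pmatrix}1&0&-2&0\\0&1&0&-2\\0&0&1&0\\0&0&0&1\end{pmatrix},$$ and $\mathrm{Mon}=\langle M_0',M_1',M_2'\rangle$. $\Gamma(2)\subset\mathrm{SL}_2(\mathbb{Z})$ is the principal congruence subgroup of level $2$. *)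

(* Defs.v *)
From HB Require Import structures.
From mathcomp Require Import all_boot all_order all_algebra.
From mathcomp Require Import boolp classical_sets functions cardinality.
From mathcomp Require Import reals complex.

Set Implicit Arguments.
Unset Strict Implicit.
Unset Printing Implicit Defensive.

Import GRing.Theory Num.Theory.

Local Open Scope classical_set_scope.
Local Open Scope card_scope.
Local Open Scope group_scope.

Section Subgroups.
Variable G : groupType.
Implicit Types (A H K S : set G).

Definition is_subgroup H : Prop :=
  H 1 /\ forall x y, H x -> H y -> H (x * y^-1).

Definition generated S : set G := smallest is_subgroup S.

(* [K : H] = n, for subgroups H and K, counting the left cosets of H in K. *)
Definition has_index K H (n : nat) : Prop :=
  H `<=` K /\ [set [set x * h | h in H] | x in K] #= `I_n.

Definition is_normal_subgroup H : Prop :=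
  is_subgroup H /\ forall x y, H x -> H (x ^ y).

End Subgroups.

(* A and B are carriers of subgroups of G and G'. Only the restriction of f
   to A matters, its values outside A are junk. *)
Definition isomorphic (G G' : groupType) (A : set G) (B : set G') : Prop :=
  exists f : G -> G',
    set_bij A B f /\ (forall x y, A x -> A y -> f (x * y) = f x * f y).

Record normalSubgroup (G : groupType) := NormalSubgroup {
  normal_set : set G;
  normal_setP : is_normal_subgroup normal_set }.

Section Quotient.
Variables (G : groupType) (N : normalSubgroup G).

Lemma normal1 : normal_set N 1.
Proof. by case: (normal_setP N) => -[]. Qed.

Lemma normalV x : normal_set N x -> normal_set N x^-1.
Proof.
case: (normal_setP N) => -[N1 ND] _ Nx.
by rewrite -[x^-1]mul1g; apply: ND.
Qed.

Lemma normalM x y : normal_set N x -> normal_set N y -> normal_set N (x * y).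
Proof.
move=> Nx Ny; have Nyv := normalV Ny; case: (normal_setP N) => -[N1 ND] _.
by rewrite -[y]invgK; apply: ND.
Qed.

Lemma normalJ x y : normal_set N x -> normal_set N (x ^ y).
Proof. by case: (normal_setP N) => _; apply. Qed.

Definition coset_rel : rel G := fun x y => `[< normal_set N (x^-1 * y) >].

Lemma coset_rel_refl : reflexive coset_rel.
Proof. by move=> x; apply/asboolP; rewrite mulVg; apply: normal1. Qed.

Lemma coset_rel_sym : symmetric coset_rel.
Proof.
move=> x y; apply/asboolP/asboolP => /normalV.
  by rewrite invgM invgK.
by rewrite invgM invgK.
Qed.

Lemma coset_rel_trans : transitive coset_rel.
Proof.
move=> y x z /asboolP Nxy /asboolP Nyz; apply/asboolP.
by rewrite -(mulVKg y z) mulgA; apply: normalM.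
Qed.

Canonical coset_equiv :=
  EquivRel coset_rel coset_rel_refl coset_rel_sym coset_rel_trans.

Definition quotient : Type := {eq_quot coset_rel}%qT.

HB.instance Definition _ := Choice.on quotient.
HB.instance Definition _ := EqQuotient.on quotient.

Definition coset (x : G) : quotient := (\pi_quotient x)%qT.

Lemma cosetP x y : coset x = coset y <-> normal_set N (x^-1 * y).
Proof.
split; first by move/eqmodP/asboolP.
by move=> ?; apply/eqmodP/asboolP.
Qed.

Definition quotient_one : quotient := coset 1.
Definition quotient_inv (u : quotient) : quotient := coset (repr u)^-1.
Definition quotient_mul (u v : quotient) : quotient :=
  coset (repr u * repr v).

Lemma coset_repr u : coset (repr u) = u.
Proof. exact: reprK. Qed.

Lemma quotient_mulE x y : quotient_mul (coset x) (coset y) = coset (x * y).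
Proof.
apply/cosetP; set x' := repr _; set y' := repr _.
have Nx : normal_set N (x'^-1 * x) by apply/cosetP; exact: coset_repr.
have Ny : normal_set N (y'^-1 * y) by apply/cosetP; exact: coset_repr.
have -> : (x' * y')^-1 * (x * y) = ((x'^-1 * x) ^ y') * (y'^-1 * y).
  by rewrite invgM /conjg !mulgA mulgK.
by apply: normalM => //; apply: normalJ.
Qed.

Lemma quotient_invE x : quotient_inv (coset x) = coset x^-1.
Proof.
apply/cosetP; set x' := repr _; rewrite invgK.
have Nx : normal_set N (x^-1 * x') by apply/cosetP; rewrite coset_repr.
have -> : x' * x^-1 = (x^-1 * x') ^ x^-1 by rewrite /conjg invgK !mulgA mulgV mul1g.
exact: normalJ.
Qed.

Lemma quotient_mulA : associative quotient_mul.
Proof.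
move=> u v w; rewrite -[u]coset_repr -[v]coset_repr -[w]coset_repr.
by rewrite !quotient_mulE mulgA.
Qed.

Lemma quotient_mul1 : left_id quotient_one quotient_mul.
Proof. by move=> u; rewrite -[u]coset_repr quotient_mulE mul1g. Qed.

Lemma quotient_1mul : right_id quotient_one quotient_mul.
Proof. by move=> u; rewrite -[u]coset_repr quotient_mulE mulg1. Qed.

Lemma quotient_mulV : left_inverse quotient_one quotient_inv quotient_mul.
Proof.
by move=> u; rewrite -[u]coset_repr quotient_invE quotient_mulE mulVg.
Qed.

Lemma quotient_mulrV : right_inverse quotient_one quotient_inv quotient_mul.
Proof.
by move=> u; rewrite -[u]coset_repr quotient_invE quotient_mulE mulgV.
Qed.

HB.instance Definition _ := isGroup.Build quotient
  quotient_mulA quotient_mul1 quotient_1mul quotient_mulV quotient_mulrV.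

Lemma cosetM x y : coset (x * y) = coset x * coset y.
Proof. by rewrite -quotient_mulE. Qed.

End Quotient.

Local Open Scope ring_scope.

Section GeneralLinear.
Variables (R : comUnitRingType) (n : nat).

Definition GL : Type := {A : 'M[R]_n | A \in unitmx}.

HB.instance Definition _ := Choice.on GL.
HB.instance Definition _ := SubChoice.on GL.

Definition GL_one : GL := exist _ 1%:M (unitmx1 R n).
Definition GL_mul (A B : GL) : GL.
Proof.
by exists (sval A *m sval B); rewrite unitmx_mul (svalP A) (svalP B).
Defined.
Definition GL_inv (A : GL) : GL.
Proof. by exists (invmx (sval A)); rewrite unitmx_inv (svalP A). Defined.

Lemma GL_mulA : associative GL_mul.
Proof. by move=> A B C; apply: val_inj; exact: mulmxA. Qed.
Lemma GL_mul1 : left_id GL_one GL_mul.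
Proof. by move=> A; apply: val_inj; exact: mul1mx. Qed.
Lemma GL_1mul : right_id GL_one GL_mul.
Proof. by move=> A; apply: val_inj; exact: mulmx1. Qed.
Lemma GL_mulV : left_inverse GL_one GL_inv GL_mul.
Proof. by move=> A; apply: val_inj; apply: mulVmx (svalP A). Qed.
Lemma GL_mulrV : right_inverse GL_one GL_inv GL_mul.
Proof. by move=> A; apply: val_inj; apply: mulmxV (svalP A). Qed.

HB.instance Definition _ := isGroup.Build GL
  GL_mulA GL_mul1 GL_1mul GL_mulV GL_mulrV.

Definition scalar_set : set GL := [set A | exists a : R, sval A = a%:M].

Lemma scalar_setP : is_normal_subgroup scalar_set.
Proof.
split; first split.
- by exists 1.
- move=> A B [a Aa] [b Bb]; exists (a * b^-1).
  by rewrite /= Aa Bb invmx_scalar -scalar_mxM.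
- move=> A B [a Aa]; exists a; rewrite /= Aa -scalar_mxC mulmxA.
  by rewrite mulVmx ?mul1mx ?(svalP B).
Qed.

Definition scalars : normalSubgroup GL := NormalSubgroup scalar_setP.

Definition pm1_set : set GL := [set A | sval A = 1%:M \/ sval A = - 1%:M].

Lemma pm1_setP : is_normal_subgroup pm1_set.
Proof.
have invN1 : invmx (- 1%:M) = - 1%:M :> 'M[R]_n.
  have XX : (- 1%:M) *m (- 1%:M) = 1%:M :> 'M[R]_n.
    by rewrite mulmxN mulNmx opprK mulmx1.
  have [uX _] := mulmx1_unit XX.
  by rewrite -[LHS]mulmx1 -[X in _ *m X]XX mulmxA mulVmx // mul1mx.
split; first split.
- by left.
- move=> A B HA HB; rewrite /pm1_set /=.
  case: HA => ->; case: HB => ->; rewrite ?invmx1 ?invN1 ?mulmx1 ?mul1mx;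
    by [left | right | left; rewrite mulmxN mulNmx opprK mulmx1].
- move=> A B [] HA; rewrite /pm1_set /= HA ?mulNmx ?mulmxN mul1mx
    mulVmx ?(svalP B) //; by [left | right].
Qed.

Definition pm1 : normalSubgroup GL := NormalSubgroup pm1_setP.

End GeneralLinear.

Definition PGL (R : comUnitRingType) (n : nat) : groupType :=
  quotient (scalars R n).

Definition to_PGL (R : comUnitRingType) (n : nat) : GL R n -> PGL R n :=
  coset (scalars R n).

(* SL_2(Z) and its subgroups are represented inside GL_2(Z). *)
Definition SL2Z : set (GL int 2) := [set A | \det (sval A) = 1].

Definition Gamma (N : nat) : set (GL int 2) :=
  SL2Z `&` [set A : GL int 2 | forall i j : 'I_2,
    (sval A i j = (1%:M : 'M[int]_2) i j %[mod N])%Z].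

(* Gamma(2) / {1, -1}, as a subgroup of GL_2(Z) / {1, -1}; it is a genuine
   quotient because -1 belongs to Gamma(2). *)
Definition PGamma2 : set (quotient (pm1 int 2)) :=
  [set coset (pm1 int 2) A | A in Gamma 2].

(* The monodromy group of Appell's system F_4(a, b, c1, c2) at a = b = 1/2,
   c1 = c2 = 1 is given by its generators in a suitable basis of solutions;
   the case of interest is F = C. *)
Section Monodromy.
Variable F : comUnitRingType.

Definition mx4 (rows : seq (seq F)) : 'M[F]_4 :=
  \matrix_(i, j) (nth [::] rows i)`_j.

Definition M0_mx : 'M[F]_4 := mx4
  [:: [::  0; 0; 0; -1];
      [::  0; 1; 0;  0];
      [::  0; 0; 1;  0];
      [:: -1; 0; 0;  0]].

Definition M1_mx : 'M[F]_4 := mx4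
  [:: [:: 1; -2; 0;  0];
      [:: 0;  1; 0;  0];
      [:: 0;  0; 1; -2];
      [:: 0;  0; 0;  1]].

Definition M2_mx : 'M[F]_4 := mx4
  [:: [:: 1; 0; -2;  0];
      [:: 0; 1;  0; -2];
      [:: 0; 0;  1;  0];
      [:: 0; 0;  0;  1]].

Local Ltac mx4_tac :=
  apply/matrixP => -[[|[|[|[|?]]]] ?] // -[[|[|[|[|?]]]] ?] //;
  rewrite !mxE !big_ord_recr big_ord0 /= !mxE /=
    ?(mulr0, mul0r, mulr1, mul1r, mulrNN, addr0, add0r) ?(addNr, subrr).

Lemma M0_unit : M0_mx \in unitmx.
Proof. by case: (@mulmx1_unit _ _ M0_mx M0_mx) => //; mx4_tac. Qed.

Lemma M1_unit : M1_mx \in unitmx.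
Proof.
case: (@mulmx1_unit _ _ M1_mx (mx4
  [:: [:: 1; 2; 0; 0]; [:: 0; 1; 0; 0]; [:: 0; 0; 1; 2]; [:: 0; 0; 0; 1]])) => //.
by mx4_tac.
Qed.

Lemma M2_unit : M2_mx \in unitmx.
Proof.
case: (@mulmx1_unit _ _ M2_mx (mx4
  [:: [:: 1; 0; 2; 0]; [:: 0; 1; 0; 2]; [:: 0; 0; 1; 0]; [:: 0; 0; 0; 1]])) => //.
by mx4_tac.
Qed.

Definition M0 : GL F 4 := exist _ M0_mx M0_unit.
Definition M1 : GL F 4 := exist _ M1_mx M1_unit.
Definition M2 : GL F 4 := exist _ M2_mx M2_unit.

Definition Mon : set (GL F 4) := generated [set M0; M1; M2].

Definition Mon_sub : set (GL F 4) :=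
  generated [set M1; M2; (M0 * M1 * M0)%g; (M0 * M2 * M0)%g].

End Monodromy.

Arguments Mon F : clear implicits.
Arguments Mon_sub F : clear implicits.

(* Main.v *)
Require Import Defs.
From mathcomp Require Import all_boot all_order all_algebra.
From mathcomp Require Import boolp classical_sets functions cardinality.
From mathcomp Require Import reals complex.
From mathcomp Require Import mxtens zify ring.

(** The generators of the subgroup are pure tensors on F^2 (x) F^2. Write
    u = (1 -2; 0 1) and l = (1 0; 2 1). Then M1 = 1 (x) u and M2 = u (x) 1,
    and conjugation by M0 turns these into l (x) 1 and 1 (x) l. So the
    subgroup consists of the A (x) B with A and B in S = <u, l>. The
    Euclidean algorithm gives Gamma(2) = {1, -1} S, and A (x) B is scalar
    exactly when A and B are 1 or -1, whence the isomorphism. The index is 2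
    because M0 is an involution that normalizes the subgroup but is not itself
    a pure tensor. *)

Set Implicit Arguments.
Unset Strict Implicit.
Unset Printing Implicit Defensive.

Import GRing.Theory Num.Theory.

Local Open Scope classical_set_scope.
Local Open Scope card_scope.
Local Open Scope group_scope.

(** * Subgroups, index two and isomorphic images *)

Section SubgroupTheory.
Variable G : groupType.
Implicit Types (H K S : set G).

Lemma is_subgroup1 H : is_subgroup H -> H 1.
Proof. by case. Qed.

Lemma is_subgroupV H x : is_subgroup H -> H x -> H x^-1.
Proof. by case=> H1 HD Hx; rewrite -[x^-1]mul1g; apply: HD. Qed.

Lemma is_subgroupM H x y : is_subgroup H -> H x -> H y -> H (x * y).
Proof.
move=> sH Hx Hy; rewrite -[y]invgK; case: (sH) => _; apply => //.
exact: is_subgroupV.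
Qed.

Lemma generated_subgroup S : is_subgroup (generated S).
Proof.
split=> [|x y Sx Sy] H [sH SH]; first exact: is_subgroup1.
by case: (sH) => _; apply; [apply: Sx | apply: Sy].
Qed.

Lemma generated_sub S : S `<=` generated S.
Proof. exact: sub_gen_smallest. Qed.

Lemma generated_min H S : is_subgroup H -> S `<=` H -> generated S `<=` H.
Proof. exact: smallest_sub. Qed.

(** The last hypothesis puts each [y] of [K] in [H] or in [x H], and these two cosets differ since
    [x] is outside [H]. *)
Lemma has_index2 K H x : is_subgroup H -> H `<=` K -> K x -> ~ H x ->
  (forall y, K y -> H y \/ H (x^-1 * y)) -> has_index K H 2.
Proof.
move=> sH HK Kx nHx KH; split=> //.
have coset1 y : H y -> [set y * h | h in H] = H.
  move=> Hy; apply/seteqP; split=> [_ [h Hh <-]|h Hh].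
    exact: is_subgroupM.
  exists (y^-1 * h); last by rewrite mulVKg.
  by apply: is_subgroupM => //; apply: is_subgroupV.
have cosetx y : H (x^-1 * y) -> [set y * h | h in H] = [set x * h | h in H].
  move=> Hy; rewrite -[in RHS](coset1 _ Hy) image_comp.
  by apply: eq_imagel => h _ /=; rewrite -mulgA mulVKg.
have -> : [set [set y * h | h in H] | y in K] = [set H; [set x * h | h in H]].
  apply/seteqP; split=> [_ [y Ky <-]|_ [] ->].
  - by case: (KH y Ky) => [/coset1 ->|/cosetx ->]; [left | right].
  - have H1 := is_subgroup1 sH; exists 1; first exact: HK.
    exact: coset1.
  - by exists x.
rewrite card_eq_sym; apply/card_set_bijP.
exists (fun i => if i == 0%N then H else [set x * h | h in H]); split.
- by move=> [|i] _ /=; [left | right].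
- have neq : H <> [set x * h | h in H].
    move=> eqH; apply: nHx; rewrite eqH; exists 1; rewrite ?mulg1 //.
    exact: is_subgroup1.
  move=> [|[|i]] [|[|j]] //=; rewrite !inE //= => _ _ E.
  by case: (neq (esym E)).
- by move=> _ [] ->; [exists 0%N | exists 1%N].
Qed.

(** This serves to put all [upper k] and [lower k] in [sanov]: nonnegative arguments go by
    induction, negative ones by inversion. *)
Lemma is_subgroup_int (phi : int -> G) H : is_subgroup H ->
  {morph phi : k l / (k + l)%R >-> k * l} -> H (phi 1%R) ->
  forall k, H (phi k).
Proof.
move=> sH phiD Hphi1.
have phi0 : phi 0%R = 1 by apply: (mulgI (phi 0%R)); rewrite -phiD addr0 mulg1.
have Hphi n : H (phi (Posz n)).
  elim: n => [|n IHn]; first by rewrite phi0; apply: is_subgroup1.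
  by rewrite -addn1 PoszD phiD; apply: is_subgroupM.
case=> n //; rewrite -[phi _]invgK; apply: is_subgroupV => //.
suff -> : (phi (Negz n))^-1 = phi (Posz n.+1) by [].
by apply: (mulgI (phi (Negz n))); rewrite mulgV -phiD NegzE addNr.
Qed.

End SubgroupTheory.

(** On [H] the maps [g] and [h] have the same fibres, so sending [g x] to [h x] is well defined and
    injective. *)
Lemma isomorphic_images (G G1 G2 : groupType) (H : set G)
    (g : G -> G1) (h : G -> G2) :
  is_subgroup H -> {morph g : x y / x * y} -> {morph h : x y / x * y} ->
  (forall x y, H x -> H y -> g x = g y <-> h x = h y) ->
  isomorphic (g @` H) (h @` H).
Proof.
move=> sH gM hM gh.
(* Any preimage of [u] in [H] will do; where there is none, [xget] returns the default [1]. *)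
pose f u := h (xget 1 [set x | H x /\ g x = u]).
have fE x : H x -> f (g x) = h x.
  move=> Hx; rewrite /f; case: xgetP => [y _ [Hy /(gh _ _ Hy Hx)] //|].
  by move=> /(_ x) [].
exists f; split; first split.
- by move=> _ [x Hx <-]; exists x; rewrite ?fE.
- move=> _ _ /set_mem[x Hx <-] /set_mem[y Hy <-].
  by rewrite !fE // => /(gh _ _ Hx Hy).
- by move=> _ [x Hx <-]; exists (g x); [exists x | rewrite fE].
- move=> _ _ [x Hx <-] [y Hy <-].
  by rewrite -gM !fE //; apply: is_subgroupM.
Qed.


Local Open Scope ring_scope.

(** * Two by two matrices and congruence subgroups *)

Lemma ord2P (i : 'I_2) : i = 0 \/ i = 1.
Proof. by case: i => -[|[|i]] Hi //; [left | right]; apply: val_inj. Qed.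

Lemma matrix2P (R : Type) (A B : 'M[R]_2) : A 0 0 = B 0 0 -> A 0 1 = B 0 1 ->
  A 1 0 = B 1 0 -> A 1 1 = B 1 1 -> A = B.
Proof.
by move=> *; apply/matrixP => i j; case: (ord2P i) => ->; case: (ord2P j) => ->.
Qed.

Lemma mulmx2E (R : pzRingType) (A B : 'M[R]_2) i j :
  (A *m B) i j = A i 0 * B 0 j + A i 1 * B 1 j.
Proof.
rewrite mxE big_ord_recl big_ord1; congr (_ + A i _ * B _ j); exact: val_inj.
Qed.

Lemma det_mx2E (R : comPzRingType) (A : 'M[R]_2) :
  \det A = A 0 0 * A 1 1 - A 0 1 * A 1 0.
Proof.
rewrite (expand_det_row _ 0) big_ord_recl big_ord1 /cofactor !det_mx11 !mxE /=.
rewrite expr0 expr1 mul1r mulN1r mulrN.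
by congr (_ * A _ _ - A _ _ * A _ _); apply: val_inj.
Qed.

(** Writing the entrywise congruence as [A = 1 + N X] lets closure be checked by matrix algebra. *)
Lemma GammaP N (A : GL int 2) : Gamma N A <->
  \det (sval A) = 1 /\ exists X, sval A = 1%:M + N%:Z *: X.
Proof.
split=> [[detA A1]|[detA [X AE]]].
  split=> //; exists (\matrix_(i, j) ((sval A i j - 1%:M i j) %/ N)%Z).
  apply/matrixP => i j; rewrite !mxE.
  have /eqP := A1 i j; rewrite eqz_mod_dvd mxE mulrC => /divzK ->.
  by rewrite addrC subrK.
split=> // i j; apply/eqP; rewrite eqz_mod_dvd AE [(1%:M + _) i j]mxE.
by rewrite addrAC subrr add0r mxE dvdz_mulr.
Qed.

Lemma Gamma_subgroup N : is_subgroup (Gamma N).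
Proof.
split=> [|A B /GammaP[detA [X AE]] /GammaP[detB [Y BE]]]; apply/GammaP.
  by split; [exact: det1 | exists 0; rewrite scaler0 addr0].
split; first by rewrite det_mulmx detA det_inv detB invr1 mul1r.
(* [A B^-1 - 1 = (A - B) B^-1 = N (X - Y) B^-1]. *)
exists ((X - Y) *m invmx (sval B)).
rewrite scalemxAl scalerBr -[N%:Z *: X](addKr 1%:M) -[N%:Z *: Y](addKr 1%:M).
rewrite -AE -BE /= [- _ + sval A]addrC addrKA mulmxBl.
by rewrite (mulmxV (svalP B)) addrC subrK.
Qed.

(** * Even unipotent matrices and the group [S] *)

(** These are the powers [u^(-k)] and, for [lower_mx], [l^k]; both families are additive in [k]. *)
Definition upper_mx (k : int) : 'M[int]_2 := 1%:M + (2 * k) *: delta_mx 0 1.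
Definition lower_mx (k : int) : 'M[int]_2 := 1%:M + (2 * k) *: delta_mx 1 0.

Lemma upper_mxD k l : upper_mx (k + l) = upper_mx k *m upper_mx l.
Proof. by apply: matrix2P; rewrite mulmx2E !mxE /=; ring. Qed.

Lemma lower_mxD k l : lower_mx (k + l) = lower_mx k *m lower_mx l.
Proof. by apply: matrix2P; rewrite mulmx2E !mxE /=; ring. Qed.

Lemma upper_mx_unit k : upper_mx k \in unitmx.
Proof.
case: (@mulmx1_unit _ _ (upper_mx k) (upper_mx (- k))) => //.
by rewrite -upper_mxD subrr /upper_mx mulr0 scale0r addr0.
Qed.

Lemma lower_mx_unit k : lower_mx k \in unitmx.
Proof.
case: (@mulmx1_unit _ _ (lower_mx k) (lower_mx (- k))) => //.
by rewrite -lower_mxD subrr /lower_mx mulr0 scale0r addr0.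
Qed.

Definition upper k : GL int 2 := exist _ (upper_mx k) (upper_mx_unit k).
Definition lower k : GL int 2 := exist _ (lower_mx k) (lower_mx_unit k).

Lemma upperD : {morph upper : k l / k + l >-> (k * l)%g}.
Proof. by move=> k l; apply: val_inj; apply: upper_mxD. Qed.

Lemma lowerD : {morph lower : k l / k + l >-> (k * l)%g}.
Proof. by move=> k l; apply: val_inj; apply: lower_mxD. Qed.

(** Sanov's group, the [S] of the overview: [upper (-1)] is [u] and [lower 1] is [l]. *)
Definition sanov : set (GL int 2) := generated [set upper (-1); lower 1].

Lemma sanov_subgroup : is_subgroup sanov.
Proof. exact: generated_subgroup. Qed.

Lemma sanov_upper k : sanov (upper k).
Proof.
(* The generator is [upper (-1)], so the family is reparametrized by [k |-> -k]. *)
rewrite -[k]opprK; apply: (is_subgroup_int (phi := upper \o -%R)).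
- exact: sanov_subgroup.
- by move=> l m /=; rewrite opprD upperD.
- by apply: generated_sub; left.
Qed.

Lemma sanov_lower k : sanov (lower k).
Proof.
apply: is_subgroup_int; [exact: sanov_subgroup | exact: lowerD |].
by apply: generated_sub; right.
Qed.

Lemma sanov_sub_Gamma2 : sanov `<=` Gamma 2.
Proof.
apply: generated_min; first exact: Gamma_subgroup.
move=> _ [] ->; apply/GammaP; split; try by rewrite det_mx2E !mxE.
  by exists (- 1 *: delta_mx 0 1); rewrite scalerA.
by exists (1 *: delta_mx 1 0); rewrite scalerA.
Qed.

(** * Euclidean descent in Gamma(2), up to sign *)

Lemma GL_eqP (R : comUnitRingType) n (A B : GL R n) : sval A = sval B -> A = B.
Proof. exact: val_inj. Qed.

Lemma pm1_cosetP (A B : GL int 2) (c : int) : c ^+ 2 = 1 ->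
  sval A = c *: sval B -> coset (pm1 int 2) A = coset (pm1 int 2) B.
Proof.
move=> c2 AE; apply/cosetP; rewrite /= /pm1_set /=.
have AAV := mulVmx (svalP A).
have BE : sval B = c *: sval A by rewrite AE scalerA -expr2 c2 scale1r.
rewrite BE -scalemxAr AAV; move/eqP: c2; rewrite sqrf_eq1 => /orP[]/eqP ->.
  by left; rewrite scale1r.
by right; rewrite scaleN1r.
Qed.

(** The units of the integers are 1 and -1, each its own inverse. *)
Lemma int_mul1 (a b : int) : a * b = 1 -> a ^+ 2 = 1 /\ b = a.
Proof.
move=> ab; have a2 : a ^+ 2 = 1.
  have /eqP := congr1 absz ab; rewrite abszM muln_eq1 => /andP[/eqP a1 _].
  by have [->|->] : a = 1 \/ a = -1 by lia.
by split=> //; rewrite -[LHS]mul1r -a2 expr2 -mulrA ab mulr1.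
Qed.

(* With a odd and c even and nonzero, |a| <> |c|, so that adding plus or minus
   twice the smaller in absolute value to the larger one decreases it. *)
Lemma euclid_step (a c p r : int) : a = 1 + 2 * p -> c = 2 * r -> c != 0 ->
  exists k, (absz (a + 2 * k * c)%R < absz a)%N
         \/ (absz (c + 2 * k * a)%R < absz c)%N.
Proof.
move=> aE cE c0.
have [|[|[|]]] : (absz (a + 2 * 1 * c)%R < absz a)%N \/
  (absz (c + 2 * 1 * a)%R < absz c)%N \/
  (absz (a + 2 * -1 * c)%R < absz a)%N \/
  (absz (c + 2 * -1 * a)%R < absz c)%N by lia.
- by exists 1; left.
- by exists 1; right.
- by exists (-1); left.
- by exists (-1); right.
Qed.

(** Descent on [|a| + |c|] for the first column [(a, c)]: left multiplication by [upper k] adds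
    [2kc] to [a], and [lower k] adds [2ka] to [c]. It stops at [c = 0]. *)
Lemma Gamma2_sanov A : Gamma 2 A ->
  exists2 B, sanov B & coset (pm1 int 2) B = coset (pm1 int 2) A.
Proof.
have [n] := ubnP (`|sval A 0%R 0%R| + `|sval A 1%R 0%R|)%N.
elim: n A => // n IHn A ltAn GA.
(* If [T] in [sanov] shortens the first column, induction applies to [T A], and multiplying the
   result by [T^-1] returns to [A]. *)
have step T : sanov T -> (`|sval (T * A)%g 0%R 0%R| +
    `|sval (T * A)%g 1%R 0%R| < `|sval A 0%R 0%R| + `|sval A 1%R 0%R|)%N ->
  exists2 B, sanov B & coset (pm1 int 2) B = coset (pm1 int 2) A.
  move=> ST ltTA; have [||B SB eqB] := IHn (T * A)%g.
  - exact: leq_trans ltTA ltAn.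
  - by apply: is_subgroupM GA; [apply: Gamma_subgroup | apply: sanov_sub_Gamma2].
  exists (T^-1 * B)%g.
    apply: is_subgroupM SB; first exact: sanov_subgroup.
    exact: is_subgroupV sanov_subgroup ST.
  by rewrite cosetM eqB -cosetM mulKg.
have stepU k := step _ (sanov_upper k); have stepL k := step _ (sanov_lower k).
have /GammaP[detA [X AE]] := GA.
have [a00 a01 a10] : [/\ exists x, sval A 0%R 0%R = 1 + 2 * x,
  exists x, sval A 0%R 1%R = 2 * x & exists x, sval A 1%R 0%R = 2 * x].
  rewrite AE; split; [exists (X 0 0) | exists (X 0 1) | exists (X 1 0)];
  by rewrite !mxE //= ?add0r.
move: detA; rewrite det_mx2E => detA.
case: a00 a01 a10 => p a00 [q a01] [r a10].
have [c0|c0] := eqVneq (sval A 1 0) 0; last first.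
  have [k [ltk|ltk]] := euclid_step a00 a10 c0;
    [apply: (stepU k) | apply: (stepL k)]; rewrite /= !mulmx2E !mxE /=
      !(mulr0, mulr1, mul0r, mul1r, addr0, add0r).
    by rewrite ltn_add2r.
  by rewrite ltn_add2l addrC.
have ad : sval A 0 0 * sval A 1 1 = 1 by rewrite -detA c0 mulr0 subr0.
have [a2 dE] := int_mul1 ad.
(* Here [A] has rows [(a, 2q)] and [(0, a)] with [a^2 = 1], so it is [a] times the unipotent matrix
   with corner entry [2aq]. *)
exists (upper (sval A 0 0 * q)); first exact: sanov_upper.
apply: esym; apply: (pm1_cosetP (c := sval A 0 0)) => //.
apply: matrix2P; rewrite !mxE /= ?(mulr0, mulr1, addr0, add0r, dE, c0) //.
by rewrite a01 -[in LHS](mul1r q) -a2; ring.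
Qed.

Lemma PGamma2_sanov : PGamma2 = coset (pm1 int 2) @` sanov.
Proof.
apply/seteqP; split=> _ [A GA <-]; last first.
  by exists A => //; apply: sanov_sub_Gamma2.
by have [B SB <-] := Gamma2_sanov GA; exists B.
Qed.

(** * Tensor products and the generators *)

Lemma scalar_tensE (R : pzRingType) m n (c : R) i j k l :
  (c%:M : 'M[R]_(m * n)) (mxtens_index (i, k)) (mxtens_index (j, l))
  = c *+ ((i == j) && (k == l)).
Proof. by rewrite !mxE (can_eq (@mxtens_indexK m n)) xpair_eqE. Qed.

Lemma tens_mx11 (R : pzRingType) m n :
  (1%:M : 'M[R]_m) *t (1%:M : 'M[R]_n) = 1%:M.
Proof.
apply/matrixP => i j; case: (mxtens_indexP i) => i1 i2.
case: (mxtens_indexP j) => j1 j2; rewrite scalar_tensE tensmxE !mxE.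
by case: (i1 == j1); rewrite ?mul1r ?mul0r.
Qed.

(** The two diagonal entries are integers with product 1, hence equal to a common sign. *)
Lemma diagonal_pm1 (A : GL int 2) : \det (sval A) = 1 ->
  (forall i j, i != j -> sval A i j = 0) -> pm1_set A.
Proof.
rewrite det_mx2E => + A0; rewrite (A0 0 1) // mul0r subr0.
case/int_mul1 => /eqP; rewrite sqrf_eq1 => a1 dE.
have AE : sval A = (sval A 0 0)%:M.
  by apply: matrix2P; rewrite !mxE /= ?(A0 0 1, A0 1 0, dE).
case/orP: a1 => /eqP a1; rewrite /pm1_set /= AE a1; first by left.
by right; rewrite raddfN.
Qed.

Section Tensor.
Variable F : numFieldType.
Implicit Types A B C D : GL int 2.

Local Notation intmx A := (map_mx intr (sval A) : 'M[F]_2).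

Lemma tens_unit A B : (intmx A *t intmx B : 'M[F]_4) \in unitmx.
Proof.
suff H : (intmx A *t intmx B) *m (intmx (A^-1)%g *t intmx (B^-1)%g) = 1%:M.
  by case: (mulmx1_unit H).
rewrite tensmx_mul -!map_mxM /= (mulmxV (svalP A)) (mulmxV (svalP B)) !map_mx1.
exact: tens_mx11.
Qed.

Definition tens A B : GL F 4 := exist _ (intmx A *t intmx B) (tens_unit A B).

Lemma tensM A B C D : tens (A * B)%g (C * D)%g = (tens A C * tens B D)%g.
Proof. apply: GL_eqP; rewrite /= !map_mxM; symmetry.
exact: (@tensmx_mul _ 2 2 2 2 2 2). Qed.

Lemma tens1 : tens 1%g 1%g = 1%g.
Proof. by apply: (mulgI (tens 1%g 1%g)); rewrite -tensM !mulg1. Qed.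

Lemma tensV A B : (tens A B)^-1%g = tens A^-1%g B^-1%g.
Proof. by apply: (mulgI (tens A B)); rewrite mulgV -tensM !mulgV tens1. Qed.

Lemma tensE A B i j k l :
  (sval (tens A B) : 'M[F]_(2 * 2)) (mxtens_index (i, k)) (mxtens_index (j, l))
  = (sval A i j * sval B k l)%:~R.
Proof. by rewrite tensmxE !mxE intrM. Qed.

Lemma mxtens2P (X : 'M[F]_(2 * 2)) A B :
  (forall i j k l : 'I_2, X (mxtens_index (i, k)) (mxtens_index (j, l))
    = (sval A i j * sval B k l)%:~R) -> X = sval (tens A B).
Proof.
move=> XE; apply/matrixP => i j.
case: (mxtens_indexP i) => i1 i2.
by case: (mxtens_indexP j) => j1 j2; rewrite XE tensE.
Qed.

Lemma M1_tens : M1 F = tens 1%g (upper (-1)).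
Proof.
apply/GL_eqP/mxtens2P => i j k l.
case: (ord2P i) (ord2P j) (ord2P k) (ord2P l) => -> [] -> [] -> [] ->;
  by rewrite !mxE /= ?mxE.
Qed.

Lemma M2_tens : M2 F = tens (upper (-1)) 1%g.
Proof.
apply/GL_eqP/mxtens2P => i j k l.
case: (ord2P i) (ord2P j) (ord2P k) (ord2P l) => -> [] -> [] -> [] ->;
  by rewrite !mxE /= ?mxE.
Qed.

Lemma M0K : (M0 F * M0 F)%g = 1%g.
Proof.
apply: GL_eqP; apply/matrixP => -[[|[|[|[|?]]]] ?] // -[[|[|[|[|?]]]] ?] //;
  rewrite !mxE !big_ord_recr big_ord0 /= !mxE /=; ring.
Qed.

Lemma M0V : ((M0 F)^-1 = M0 F)%g.
Proof. by apply: (mulgI (M0 F)); rewrite mulgV M0K. Qed.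

(* Identify F^2 (x) F^2 with the 2x2 matrices, so that A (x) B sends X to
   A X B^T. Then M0 is X |-> - adj X, and conjugation by it exchanges the two
   factors, replacing them by their inverse transposes. *)
Lemma M0M1M0_tens : (M0 F * M1 F * M0 F)%g = tens (lower 1) 1%g.
Proof.
(* Cancelling the involution leaves [M1 M0 = M0 (l (x) 1)], with a single product on each side to
   compare entrywise. *)
apply: (mulgI (M0 F)); rewrite !mulgA M0K mul1g.
apply: GL_eqP; apply/matrixP => -[[|[|[|[|?]]]] ?] // -[[|[|[|[|?]]]] ?] //;
  rewrite !mxE !big_ord_recr !big_ord0 /= !mxE /= ?mxE /=; ring.
Qed.

Lemma M0M2M0_tens : (M0 F * M2 F * M0 F)%g = tens 1%g (lower 1).
Proof.
apply: (mulgI (M0 F)); rewrite !mulgA M0K mul1g.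
apply: GL_eqP; apply/matrixP => -[[|[|[|[|?]]]] ?] // -[[|[|[|[|?]]]] ?] //;
  rewrite !mxE !big_ord_recr !big_ord0 /= !mxE /= ?mxE /=; ring.
Qed.

(** A zero entry of [M0] would give [A00 B01 = 0], while two others would give [A00 B11 = 1] and
    [A01 B01 = -1]. *)
Lemma M0_not_tens A B : M0 F <> tens A B.
Proof.
move=> /(congr1 sval) /= E.
have Eij i j k l :
  (M0_mx F : 'M[F]_(2 * 2)) (mxtens_index (i, k)) (mxtens_index (j, l))
    = (sval A i j * sval B k l)%:~R by rewrite -tensE E.
have := Eij 0 1 0 1; have := Eij 0 0 1 1; have := Eij 0 0 0 1.
rewrite !mxE /= => /esym/eqP; rewrite intr_eq0 mulf_eq0.
case/orP => /eqP ->; rewrite ?(mul0r, mulr0) => /esym/eqP.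
  by rewrite eq_sym oner_eq0.
by move=> _ /eqP; rewrite oppr_eq0 oner_eq0.
Qed.

(** * The subgroup as a group of tensors, and its index *)

Lemma Mon_sub_subgroup : is_subgroup (Mon_sub F).
Proof. exact: generated_subgroup. Qed.

Lemma Mon_sub_tens :
  Mon_sub F = (fun p => tens p.1 p.2) @` (sanov `*` sanov).
Proof.
have sT := sanov_subgroup; have sM := Mon_sub_subgroup.
apply/seteqP; split.
  apply: generated_min.
    split=> [|_ _ [[A B] [/= SA SB] <-] [[C D] [/= SC SD] <-]].
      by exists (1, 1)%g; [split; apply: is_subgroup1 | rewrite tens1].
    exists (A * C^-1, B * D^-1)%g; last by rewrite tensV -tensM.
    by case: (sT) => _ TD; split; apply: TD.
  move=> _ [[[->|->]|->]|->].
  - exists (1%g, upper (-1)); last by rewrite M1_tens.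
    by split; [apply: is_subgroup1 | apply: sanov_upper].
  - exists (upper (-1), 1%g); last by rewrite M2_tens.
    by split; [apply: sanov_upper | apply: is_subgroup1].
  - exists (lower 1, 1%g); last by rewrite M0M1M0_tens.
    by split; [apply: sanov_lower | apply: is_subgroup1].
  - exists (1%g, lower 1); last by rewrite M0M2M0_tens.
    by split; [apply: is_subgroup1 | apply: sanov_lower].
move=> _ [[A B] [/= SA SB] <-].
(* Since [A (x) B = (A (x) 1)(1 (x) B)], each factor can be treated alone: the [A] with [A (x) 1] in
   [Mon_sub] form a subgroup containing [u] and [l]. *)
have HA : sanov `<=` [set A | Mon_sub F (tens A 1%g)].
  apply: generated_min.
    split=> [|C D]; first by rewrite /= tens1; apply: is_subgroup1.
    rewrite /= => SC SD; have -> : (1 = 1 * 1^-1 :> GL int 2)%g by rewrite mulgV.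
    by rewrite tensM -tensV; case: (sM) => _; apply.
  move=> _ [] ->; apply: generated_sub => /=.
    by rewrite -M2_tens; left; left; right.
  by rewrite -M0M1M0_tens; left; right.
have HB : sanov `<=` [set B | Mon_sub F (tens 1%g B)].
  apply: generated_min.
    split=> [|C D]; first by rewrite /= tens1; apply: is_subgroup1.
    rewrite /= => SC SD; have -> : (1 = 1 * 1^-1 :> GL int 2)%g by rewrite mulgV.
    by rewrite tensM -tensV; case: (sM) => _; apply.
  move=> _ [] ->; apply: generated_sub => /=.
    by rewrite -M1_tens; left; left; left.
  by rewrite -M0M2M0_tens; right.
rewrite -[A]mulg1 -[B]mul1g tensM.
exact: (is_subgroupM sM (HA _ SA) (HB _ SB)).
Qed.

(** Conjugation by the involution [M0] permutes the four generators in two pairs. *)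
Lemma Mon_subJ X : Mon_sub F X -> Mon_sub F (M0 F * X * M0 F)%g.
Proof.
have sM := Mon_sub_subgroup.
apply: (@generated_min _ [set X | Mon_sub F (M0 F * X * M0 F)%g]).
  split=> [|Y Z /= MY MZ]; first by rewrite /= mulg1 M0K; apply: is_subgroup1.
  have -> : (M0 F * (Y * Z^-1) * M0 F =
             (M0 F * Y * M0 F) * (M0 F * Z * M0 F)^-1)%g.
    by rewrite !invgM M0V !mulgA -[(_ * Y * M0 F * M0 F)%g]mulgA M0K mulg1.
  by case: (sM) => _; apply.
have M0JK Y : (M0 F * (M0 F * Y * M0 F) * M0 F = Y)%g.
  by rewrite !mulgA M0K mul1g -mulgA M0K mulg1.
by move=> _ [[[->|->]|->]|->]; rewrite /= ?M0JK; apply: generated_sub;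
  [left; right | right | left; left; left | left; left; right].
Qed.

Lemma Mon_index2 : has_index (Mon F) (Mon_sub F) 2.
Proof.
have sM := Mon_sub_subgroup.
have sMon := generated_subgroup [set M0 F; M1 F; M2 F].
have [Mon0 Mon1 Mon2] : [/\ Mon F (M0 F), Mon F (M1 F) & Mon F (M2 F)].
  by split; apply: generated_sub; [left; left | left; right | right].
have MonJ X : Mon F X -> Mon F (M0 F * X * M0 F)%g.
  by move=> MX; exact: is_subgroupM sMon (is_subgroupM sMon Mon0 MX) Mon0.
apply: (@has_index2 _ _ _ (M0 F)) => //.
- by apply: generated_min => // _ [[[->|->]|->]|->] //; apply: MonJ.
- by rewrite Mon_sub_tens => -[[A B] _ /esym]; apply: M0_not_tens.
(* The union of [Mon_sub] and [M0 Mon_sub] is shown to be a subgroup containing [M0], [M1] and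
   [M2]. *)
rewrite M0V; apply: generated_min.
  split=> [|Y Z]; first by left; apply: is_subgroup1.
  have [_ MD] := sM.
  (* When [M0 Z] is in [Mon_sub], [Z^-1 = (M0 Z)^-1 M0] leaves an [M0] on the right; paired with one
     on the left it is a conjugation, handled by [Mon_subJ]. *)
  case=> HY [] HZ; rewrite /=.
  - by left; apply: MD.
  - right; have -> : (M0 F * (Y * Z^-1) = M0 F * (Y * (M0 F * Z)^-1) * M0 F)%g.
      by rewrite invgM M0V -!mulgA M0K mulg1.
    by apply: Mon_subJ; apply: MD.
  - by right; rewrite mulgA; apply: MD.
  - left; have -> : (Y * Z^-1 =
      M0 F * ((M0 F * Y) * (M0 F * Z)^-1) * M0 F)%g.
      by rewrite invgM M0V !mulgA M0K mul1g -!mulgA M0K mulg1.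
    by apply: Mon_subJ; apply: MD.
move=> _ [[->|->]|->]; rewrite /=.
- by right; rewrite M0K; apply: is_subgroup1.
- by left; apply: generated_sub; left; left; left.
- by left; apply: generated_sub; left; left; right.
Qed.

(** * Which tensors are scalar *)

(** For [i != j] every product [A_ij B_kl] vanishes; cancelling a nonzero entry of [B] makes [A]
    diagonal, and symmetrically for [B]. Determinant 1 then leaves only signs. *)
Lemma tens_scalar_pm1 A B : \det (sval A) = 1 -> \det (sval B) = 1 ->
  scalar_set (tens A B) -> pm1_set A /\ pm1_set B.
Proof.
move=> detA detB [c /= AB].
have E i j k l : (sval A i j * sval B k l)%:~R = c *+ ((i == j) && (k == l)).
  by rewrite -tensE -(@scalar_tensE _ 2 2) -AB.
(* Characteristic zero brings the vanishing in [F] back to the integers. *)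
have offdiag i j k l : ~~ ((i == j) && (k == l)) -> sval A i j * sval B k l = 0.
  by move=> /negbTE ijkl; apply/eqP; rewrite -(intr_eq0 F) E ijkl.
have rowN0 (X : GL int 2) : \det (sval X) = 1 ->
    sval X 0 0 != 0 \/ sval X 0 1 != 0.
  rewrite det_mx2E; have [->|_] := eqVneq (sval X 0 0) 0; last by left.
  by have [->|_] := eqVneq (sval X 0 1) 0; [rewrite !mul0r | right].
have A0 i j : i != j -> sval A i j = 0.
  move=> /negbTE ij; have [] := rowN0 B detB => /mulIf; apply;
  by rewrite mul0r offdiag // ij.
have B0 k l : k != l -> sval B k l = 0.
  move=> /negbTE kl; have [] := rowN0 A detA => /mulfI; apply;
  by rewrite mulr0 offdiag // kl andbF.
by split; apply: diagonal_pm1.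
Qed.

Lemma pm1_tens_scalar A B : pm1_set A -> pm1_set B -> scalar_set (tens A B).
Proof.
have tN (X Y : 'M[F]_2) : (- X) *t Y = - (X *t Y).
  by apply/matrixP => i j; rewrite !mxE mulNr.
have tNr (X Y : 'M[F]_2) : X *t (- Y) = - (X *t Y).
  by apply/matrixP => i j; rewrite !mxE mulrN.
move=> HA HB; suff [] : sval (tens A B) = 1%:M \/ sval (tens A B) = - 1%:M.
- by exists 1.
- by exists (-1); rewrite raddfN.
by case: HA HB => [] HA [] HB;
  rewrite /= HA HB ?map_mxN map_mx1 ?tN ?tNr tens_mx11 ?opprK; [left|right|right|left].
Qed.

End Tensor.

(** * Index and projective isomorphism *)

Theorem mainTheorem7 (R : realType) :
  has_index (Mon R[i]) (Mon_sub R[i]) 2 /\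
  isomorphic [set to_PGL A | A in Mon_sub R[i]] (PGamma2 `*` PGamma2).
Proof.
split; first exact: Mon_index2.
have sS := sanov_subgroup.
(* Both groups become images of [sanov] times [sanov], so only the fibres of the two maps remain to
   be compared. *)
have -> : PGamma2 `*` PGamma2 =
  (fun p => (coset (pm1 int 2) p.1, coset (pm1 int 2) p.2)) @` (sanov `*` sanov).
  rewrite PGamma2_sanov; apply/seteqP; split.
    by move=> [_ _] [/= [A SA <-] [B SB <-]]; exists (A, B).
  by move=> _ [[A B] [/= SA SB] <-]; split; [exists A | exists B].
rewrite Mon_sub_tens image_comp; apply: isomorphic_images.
- split=> [|[A B] [C D] [/= SA SB] [/= SC SD]].
    by split; apply: is_subgroup1.
  by case: (sS) => _ SD'; split; apply: SD'.
- by move=> [A B] [C D] /=; rewrite tensM; apply: cosetM.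
- by move=> [A B] [C D] /=; rewrite !cosetM.
move=> [A B] [C D] [/= SA SB] [/= SC SD].
have detS X Y : sanov X -> sanov Y -> \det (sval (X^-1 * Y)%g) = 1.
  move=> SX SY; suff /sanov_sub_Gamma2[] : sanov (X^-1 * Y)%g by [].
  exact: is_subgroupM sS (is_subgroupV sS SX) SY.
split.
  (* Equal classes in PGL mean that [A^-1 C (x) B^-1 D] is scalar, hence that both factors are
     signs. *)
  move/cosetP; rewrite tensV -tensM => /tens_scalar_pm1[]; try exact: detS.
  by move=> AC BD; congr pair; apply/cosetP.
case=> /cosetP AC /cosetP BD; apply/cosetP; rewrite tensV -tensM.
exact: pm1_tens_scalar.
Qed.
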